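(* Let $d\ge 1$, $I=[0,1)^d$, and let $S\subset\mathbb{R}^d$ be a non-empty set such that $I+S=\{I+s\colon s\in S\}$ is a packing of $\mathbb{R}^d$. Suppose that for every two vectors $t,t'\in S$, if $t-t'\in\{-1,0,1\}^d$, then the number $|\{i\in[d]\colon |t_i-t'_i|=1\}|$ is even. Then $F=\bigcup_{s\in S}(I+s)$ is rough. In particular, $F$ is rigid.
   Context: $I+S$ is called a packing of $\mathbb{R}^d$ (by unit cubes) if the cubes $I+s$, $s\in S$, are pairwise disjoint; equivalently, for every two distinct $t,t'\in S$ there is $i\in[d]$ with $|t_i-t'_i|\ge 1$. A packing $I+S$ is a tiling of $F\subseteq\mathbb{R}^d$ if $F=\bigcup_{s\in S}(I+s)$. The set $F=\bigcup_{s\in S}(I+s)$ is called rough if for every $u\in\mathbb{R}^d$ the inclusion $I+u\subseteq F$ implies $u\in S$. $F$ is called rigid if $I+S$ is the unique tiling of $F$ by translates of $I$ (i.e. if $I+S'$ is a packing with $\bigcup(I+S')=F$, then $S'=S$). $[d]=\{1,\dots,d\}$. *)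

(* Defs.v *)
From HB Require Import structures.
From mathcomp Require Import all_boot all_order all_algebra.
From mathcomp Require Import all_classical all_reals.

Set Implicit Arguments.
Unset Strict Implicit.
Unset Printing Implicit Defensive.

Import Order.TTheory GRing.Theory Num.Theory.

Local Open Scope classical_set_scope.
Local Open Scope ring_scope.

Section Defs.
Variables (R : realType) (d : nat).
Implicit Types (S : set 'rV[R]_d) (F : set 'rV[R]_d) (u : 'rV[R]_d).

Definition unit_cube : set 'rV[R]_d :=
  [set x | forall i, x ord0 i \in `[0, 1[].

Definition cube u : set 'rV[R]_d := [set x + u | x in unit_cube].

Definition packing S : Prop := trivIset S cube.

Definition cube_union S : set 'rV[R]_d := \bigcup_(s in S) cube s.

Definition tiling S F : Prop := packing S /\ F = cube_union S.

(* Roughness and rigidity of F are relative to the given tiling I + S of F,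
   hence the extra argument S. *)
Definition rough S F : Prop := forall u, cube u `<=` F -> S u.

Definition rigid S F : Prop :=
  tiling S F /\ forall S', tiling S' F -> S' = S.

End Defs.

(* Main.v *)
Require Import Defs.
From HB Require Import structures.
From mathcomp Require Import all_boot all_order all_algebra.
From mathcomp Require Import all_classical all_reals.
From mathcomp Require Import lra.

(** Suppose [cube u] is covered by cubes of [S].  Each [s] near [u] cuts the
    [i]-th edge of [cube u] at a point [cut u s i] in ]0, 1], and two cubes with
    the same cuts differ by a vector of {-1, 0, 1}^d.  Choose [m] near [u] with
    the smallest sum of cuts, and look at the grid of points of [cube u] whose
    [i]-th coordinate is [u i] or [u i + cut u m i] (only [u i] when the cut is
    1), each weighted by the parity of the number of coordinates equal to [u i].
    If [m != u] the weights sum to 0.  If the cube covering a point does not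
    separate the two values of some coordinate [i], then switching that
    coordinate stays in the same cube and changes the weight, so such points
    cancel out.  By minimality, each remaining point lies in a cube with the
    same cuts as [m] and is the only grid point in it; by the parity
    hypothesis all their weights are equal, so they cannot sum to 0. *)

Set Implicit Arguments.
Unset Strict Implicit.
Unset Printing Implicit Defensive.

Import Order.TTheory GRing.Theory Num.Theory.

Local Open Scope classical_set_scope.
Local Open Scope ring_scope.

Definition symdiff (T : finType) (A B : {set T}) : {set T} :=
  [set x | (x \in A) (+) (x \in B)]%SET.

Lemma odd_card_symdiff (T : finType) (A B : {set T}) :
  odd #|symdiff A B| = odd #|A| (+) odd #|B|.
Proof.
have cardI (C D : {set T}) :
    odd #|C| = odd #|C :&: D|%SET (+) odd #|C :\: D|%SET.
  by rewrite -oddD cardsID.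
rewrite (cardI _ A) (cardI A B) (cardI B A) finset.setIC.
have -> : (A :&: symdiff A B = A :\: B)%SET.
  by apply/setP => x; rewrite !inE; case: (x \in A); case: (x \in B).
have -> : (symdiff A B :\: A = B :\: A)%SET.
  by apply/setP => x; rewrite !inE; case: (x \in A); case: (x \in B).
rewrite [(B :&: A)%SET]finset.setIC.
by case: (odd _); case: (odd _); case: (odd _).
Qed.

Lemma symdiffK (T : finType) (A B : {set T}) : symdiff (symdiff A B) B = A.
Proof.
by apply/setP => x; rewrite !inE; case: (x \in A); case: (x \in B).
Qed.

(** Reindexing along [h] reverses every sign, so the sum equals its own negative. *)
Lemma sum_sign_involution (T : finType) (P : pred {set T})
    (h : {set T} -> {set T}) :
    (forall A, P A -> [/\ P (h A), h (h A) = A & odd #|h A| = ~~ odd #|A|]) ->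
  \sum_(A | P A) (-1) ^+ #|A| = 0 :> int.
Proof.
move=> hP; set s := \sum_(A | P A) _.
suff sN : s = - s.
  have /eqP : s *+ 2 = 0 by rewrite mulr2n {2}sN subrr.
  by rewrite mulrn_eq0 => /eqP.
rewrite {1}/s (reindex_onto h h) => [|A /hP[]//].
rewrite -sumrN; apply: eq_big => [A|A /andP[PhA /eqP hhA]].
  apply/andP/idP => [[PhA /eqP hhA]|/hP[-> ->]//].
  by have [] := hP _ PhA; rewrite hhA.
have [PA _ _] := hP _ PhA; rewrite hhA in PA.
have [_ _ oddh] := hP _ PA.
by rewrite -signr_odd oddh signrN signr_odd.
Qed.

Section Cubes.
Variables (R : realType) (d : nat).
Implicit Types (S : set 'rV[R]_d) (s t u x : 'rV[R]_d) (T : {set 'I_d}).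

Lemma cubeP u x :
  cube u x <-> forall i, u ord0 i <= x ord0 i < u ord0 i + 1.
Proof.
split=> [[y y01 <-] i|ux].
  by have := y01 i; rewrite in_itv /= !mxE => /andP[]; lra.
exists (x - u); last by rewrite subrK.
by move=> i; rewrite in_itv /= !mxE; have /andP[] := ux i; lra.
Qed.

Lemma cube_self u : cube u u.
Proof. by apply/cubeP => i; lra. Qed.

Lemma packing_eq S s t x :
  packing S -> S s -> S t -> cube s x -> cube t x -> s = t.
Proof. by move=> pS Ss St sx tx; apply: pS => //; exists x. Qed.

(** Roughness puts every rival tiling inside [S]; the rival cube covering the point [s] of [S] is
    then a cube of [S] meeting [cube s], hence equal to it. *)
Lemma rough_rigid S :
  packing S -> rough S (cube_union S) -> rigid S (cube_union S).
Proof.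
move=> pS rS; split=> // S' [pS' FE].
have S'S : S' `<=` S.
  by move=> s S's; apply: rS; rewrite FE; exact: bigcup_sup.
apply/seteqP; split=> // s Ss.
have : cube_union S s by exists s => //; exact: cube_self.
rewrite FE => -[t S't ts].
by rewrite (packing_eq pS Ss (S'S _ S't) (@cube_self s) ts).
Qed.

Definition near u s := forall i, u ord0 i - 1 < s ord0 i < u ord0 i + 1.

Lemma cube_near u s x : cube u x -> cube s x -> near u s.
Proof. by move=> /cubeP ux /cubeP sx i; have := ux i; have := sx i; lra. Qed.

Definition lowset u s : {set 'I_d} := [set i | s ord0 i <= u ord0 i]%SET.

(* The cut that [cube s] makes in the [i]-th edge of [cube u]; [1] means that
   the whole edge is covered. *)
Definition cut u s i : R := s ord0 i - u ord0 i + (i \in lowset u s)%:R.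

(** Both cubes contain the vertex of the closed cube at [u] whose [i]-th coordinate is [u i] on the
    common [lowset] and [u i + 1] elsewhere. *)
Lemma lowset_inj S u s t : packing S -> S s -> S t -> near u s -> near u t ->
  lowset u s = lowset u t -> s = t.
Proof.
move=> pS Ss St us ut st.
apply: (@packing_eq _ _ _
  (\row_i (u ord0 i + (i \notin lowset u s)%:R)) pS Ss St).
  apply/cubeP => i; rewrite !mxE inE; have := us i.
  by case: (leP (s ord0 i) (u ord0 i)) => /=; lra.
apply/cubeP => i; rewrite !mxE st inE; have := ut i.
by case: (leP (t ord0 i) (u ord0 i)) => /=; lra.
Qed.

(** By [lowset_inj] only finitely many vectors of [S] are near [u], so some [m] minimizes the sum of
    cuts; cuts that nowhere exceed those of [m] must then equal them. *)
Lemma exists_min_cut S u s0 : packing S -> S s0 -> near u s0 ->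
  exists2 m, S m /\ near u m &
    forall s, S s -> near u s -> (forall i, cut u s i <= cut u m i) ->
      forall i, cut u s i = cut u m i.
Proof.
move=> pS Ss0 us0.
pose Q T s := [/\ S s, near u s & lowset u s = T].
have /choice[c cP] : forall T, exists s, (exists s, Q T s) -> Q T s.
  move=> T; have [[s Qs]|nQ] := pselect (exists s, Q T s); first by exists s.
  by exists s0.
have cE s : S s -> near u s -> c (lowset u s) = s.
  move=> Ss us; have [|Sc uc] := cP (lowset u s); first by exists s.
  exact: (lowset_inj pS Sc Ss uc us).
pose w s := \sum_i cut u s i.
have Q0 : `[< exists s, Q (lowset u s0) s >] by apply/asboolP; exists s0.
have [T /asboolP/cP[Sm um _] mmin] :=
  @arg_minP _ _ _ (lowset u s0) (fun T => `[< exists s, Q T s >]) (w \o c) Q0.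
exists (c T) => // s Ss us le_s i.
have := mmin (lowset u s); rewrite /= cE // => le_w.
have {le_w} : w (c T) <= w s by apply: le_w; apply/asboolP; exists s.
rewrite /w (bigD1 i) //= [leRHS](bigD1 i) //= => le_w.
have : \sum_(j | j != i) cut u s j <= \sum_(j | j != i) cut u (c T) j.
  exact: ler_sum.
by have := le_s i; lra.
Qed.

Definition even_twins S := forall t t', S t -> S t' ->
  (forall i : 'I_d, (t - t') ord0 i \in [:: -1; 0; 1]) ->
  ~~ odd #|[set i : 'I_d | `|t ord0 i - t' ord0 i| == 1]%SET|.

(** With equal cuts, [s - t] is a difference of indicators of the two lowsets, so its entries of
    modulus 1 sit exactly on their symmetric difference. *)
Lemma odd_lowset S u s t : even_twins S -> S s -> S t ->
  (forall i, cut u s i = cut u t i) ->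
  odd #|lowset u s| = odd #|lowset u t|.
Proof.
move=> evenS Ss St st.
suff : ~~ odd #|symdiff (lowset u s) (lowset u t)|.
  by rewrite odd_card_symdiff; do 2!case: (odd _).
have stE i : s ord0 i - t ord0 i =
    (i \in lowset u t)%:R - (i \in lowset u s)%:R.
  by have := st i; rewrite /cut; lra.
have -> : symdiff (lowset u s) (lowset u t) =
    [set i | `|s ord0 i - t ord0 i| == 1]%SET.
  apply/setP => i; rewrite [RHS]inE stE !inE.
  by case: (s ord0 i <= _); case: (t ord0 i <= _);
    rewrite /= ?subrr ?subr0 ?sub0r ?normrN ?normr0 ?normr1 ?eqxx //
       eq_sym oner_eq0.
apply: evenS => // i; rewrite !mxE stE !inE.
by case: (s ord0 i <= _); case: (t ord0 i <= _);
  rewrite /= ?subrr ?subr0 ?sub0r eqxx ?orbT.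
Qed.

Lemma rough_even S : packing S -> even_twins S -> rough S (cube_union S).
Proof.
move=> pS evenS u uF.
have [s0 Ss0 s0u] := uF _ (@cube_self u).
have [m [Sm um] mmin] := exists_min_cut pS Ss0 (cube_near (@cube_self u) s0u).
pose b := cut u m.
have cut01 s i : near u s -> 0 < cut u s i <= 1.
  by move=> /(_ i); rewrite /cut inE; case: (leP (s ord0 i) (u ord0 i)) => /=; lra.
pose Z : {set 'I_d} := [set i | b i == 1]%SET.
(* If all cuts are 1, nearness forces [m = u]. *)
have [/forallP Zall|/forallPn[i0 Zi0]] := boolP [forall i, i \in Z].
  suff <- : m = u by [].
  apply/rowP => i; have := Zall i; rewrite inE /b /cut inE => /eqP.
  by have := um i; case: (leP (m ord0 i) (u ord0 i)) => /=; lra.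
(* [T] is the set of coordinates in which the grid point agrees with [u]. *)
pose x T : 'rV[R]_d := \row_i (u ord0 i + (i \notin T)%:R * b i).
have b1 i : i \notin Z -> b i < 1.
  by rewrite inE lt_neqAle => ->; have /andP[] := cut01 m i um.
have xu T : (Z \subset T)%SET -> cube u (x T).
  move=> ZT; apply/cubeP => i; rewrite mxE.
  have [iT|iT] := boolP (i \in T); rewrite ?mul0r ?mul1r; first by lra.
  have /b1 : i \notin Z by apply: contra iT; apply/fintype.subsetP.
  by have := cut01 m i um; rewrite -/(b i); lra.
have /choice[g gP] : forall T, exists s,
    (Z \subset T)%SET -> [/\ S s, near u s & cube s (x T)].
  move=> T; have [ZT|nZT] := boolP (Z \subset T)%SET; last by exists u.
  have [s Ss sx] := uF _ (xu T ZT).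
  by exists s => _; split => //; exact: cube_near (xu T ZT) sx.
have gE T s : (Z \subset T)%SET -> S s -> cube s (x T) -> g T = s.
  by move=> ZT Ss sx; have [Sg _ gx] := gP T ZT; exact: (packing_eq pS Sg Ss gx).
(* A cut beyond [b i] means that the cube of [g T], which covers one of the values [u i] and
   [u i + b i], covers both. *)
pose bad T := [pick i | (i \notin Z) && (b i < cut u (g T) i)].
pose flip i T := symdiff T [set i]%SET.
have flipZ i T : i \notin Z -> (Z \subset T)%SET -> (Z \subset flip i T)%SET.
  move=> iZ /fintype.subsetP ZT; apply/fintype.subsetP => j jZ; rewrite !inE (ZT j jZ).
  by case: eqP jZ iZ => // -> ->.
have flipK i T : flip i (flip i T) = T by exact: symdiffK.
have odd_flip i T : odd #|flip i T| = ~~ odd #|T|.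
  by rewrite odd_card_symdiff cards1 addbT.
have sum_all : \sum_(T : {set 'I_d} | (Z \subset T)%SET) (-1) ^+ #|T| = 0 :> int.
  apply: (@sum_sign_involution _ _ (flip i0)) => T ZT.
  by rewrite flipZ // flipK odd_flip.
have sum_bad :
    \sum_(T : {set 'I_d} | (Z \subset T)%SET && (bad T : bool)) (-1) ^+ #|T| = 0
      :> int.
  apply: (@sum_sign_involution _ _
    (fun T => if bad T is Some i then flip i T else T)) => T /andP[ZT].
  case badT : (bad T) => [i|//] _.
  have [iZ bi] : i \notin Z /\ b i < cut u (g T) i.
    by move: badT; rewrite /bad; case: pickP => // j /andP[? ?] [<-].
  have gflip : g (flip i T) = g T.
    have [Sg ug /cubeP gx] := gP T ZT.
    apply: gE => //; first exact: flipZ.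
    apply/cubeP => j; have := gx j; rewrite !mxE !inE.
    have [->|_] := eqVneq j i; last by rewrite addbF.
    move: bi; rewrite /cut inE; have := ug i; have := cut01 m i um.
    rewrite -/(b i); case: (leP (g T ord0 i) (u ord0 i)) => /=;
      case: (i \in T) => /=; lra.
  (* [bad] sees [T] only through [g T], so the same coordinate is switched back. *)
  have -> : bad (flip i T) = Some i by rewrite -badT /bad gflip.
  by rewrite flipZ // flipK odd_flip.
(* A half-open side with cut [b i] contains just one of [u i] and [u i + b i]: the former exactly
   when [i] is in the lowset. *)
have cut_low s T : S s -> near u s -> (Z \subset T)%SET ->
    (forall i, cut u s i = b i) -> cube s (x T) <-> T = lowset u s.
  move=> Ss us /fintype.subsetP ZT sb; split=> [/cubeP sx|TE].
    apply/setP => i; rewrite inE; have := sx i; have := sb i; have := us i.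
    rewrite mxE /cut inE.
    have := cut01 m i um; rewrite -/(b i).
    have [iZ|iZ] := boolP (i \in Z).
      rewrite ZT //; move: iZ; rewrite inE => /eqP ->.
      by case: (leP (s ord0 i) (u ord0 i)) => //=; lra.
    by have := b1 i iZ; case: (leP (s ord0 i) (u ord0 i)) => /=;
      case: (i \in T) => //=; lra.
  apply/cubeP => i; rewrite mxE TE; have := sb i; have := us i.
  have := cut01 m i um; rewrite -/(b i) /cut inE.
  by case: (leP (s ord0 i) (u ord0 i)) => /=; lra.
have low_sup s : near u s -> (forall i, cut u s i = b i) ->
    (Z \subset lowset u s)%SET.
  move=> us sb; apply/fintype.subsetP => i; rewrite !inE -sb /cut inE => /eqP.
  by have := us i; case: (leP (s ord0 i) (u ord0 i)) => //=; lra.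
(* No cut exceeds [b]: on [Z] because cuts are at most 1, elsewhere because no coordinate is bad.
   Minimality of [m] gives equality. *)
have good T : (Z \subset T)%SET -> ~~ bad T -> forall i, cut u (g T) i = b i.
  move=> ZT; rewrite /bad; case: pickP => // nbad _.
  have [Sg ug _] := gP T ZT; apply: mmin => // i.
  have [iZ|iZ] := boolP (i \in Z).
    by move: iZ; rewrite inE -/(b i) => /eqP ->; have /andP[] := cut01 _ i ug.
  by move: (nbad i); rewrite iZ /= ltNge => /negbFE.
have sign_good T : (Z \subset T)%SET -> ~~ bad T ->
    odd #|T| = odd #|lowset u m|.
  move=> ZT nbad; have gb := good T ZT nbad; have [Sg ug gx] := gP T ZT.
  have /(cut_low _ _ Sg ug ZT gb) -> := gx.
  by apply: (odd_lowset evenS Sg Sm) => i; exact: gb.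
have mZ : (Z \subset lowset u m)%SET by apply: low_sup.
have gm : g (lowset u m) = m by apply: gE => //; apply/cut_low.
exfalso.
have : \sum_(T : {set 'I_d} | (Z \subset T)%SET && ~~ bad T) (-1) ^+ #|T| = 0
    :> int.
  by move: sum_all; rewrite (bigID (fun T => bad T : bool)) /= sum_bad add0r.
(* All remaining terms carry one sign, and [lowset u m] indexes one of them. *)
under eq_bigr => A /andP[ZA nbadA] do rewrite -signr_odd sign_good //.
rewrite sumr_const => /eqP; rewrite mulrn_eq0 signr_eq0 orbF.
apply/negP; rewrite -lt0n; apply/card_gt0P; exists (lowset u m).
rewrite unfold_in mZ /bad; case: pickP => // i.
by rewrite gm -/(b i) ltxx andbF.
Qed.

End Cubes.

Theorem theorem1 (R : realType) (d : nat) (hd : (1 <= d)%N)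
    (S : set 'rV[R]_d) (S_neq0 : S !=set0) (S_packing : packing S)
    (S_even : forall t t' : 'rV[R]_d, S t -> S t' ->
       (forall i : 'I_d, (t - t') ord0 i \in [:: -1; 0; 1]) ->
       ~~ odd #|[set i : 'I_d | `|t ord0 i - t' ord0 i| == 1]%SET|) :
  rough S (cube_union S) /\ rigid S (cube_union S).
Proof.
have S_rough := rough_even S_packing S_even.
by split=> //; exact: rough_rigid.
Qed.
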